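(* For every integer $k\geqslant 1$, $$\frac{1}{2}\,\zeta^{2}(2k+1)+\zeta(4k+2)=\sum_{n=1}^{+\infty}\frac{c_{k}(n)}{n^{4k+1}}.$$
   Context: $\zeta$ denotes the Riemann zeta function and $\psi(z)=\Gamma'(z)/\Gamma(z)$ the digamma function. For integers $k\geqslant 1$ and $r\geqslant 0$ put $\omega_{r}=\omega_{r}(k)=\exp\bigl(\frac{2\pi i(r+1/2)}{2k+1}\bigr)$. For real $w>0$ define $c_{k}(w)=\frac{1}{2k+1}\sum_{r=0}^{2k}\omega_{r}\psi(-\omega_{r}w)$. *)

(* Defs.v *)
From Stdlib Require Import Reals Factorial.
From Coquelicot Require Import Coquelicot.

Open Scope R_scope.

(* Total, coordinatewise limit: meaningful when the sequence converges in C. *)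
Definition Clim_seq (u : nat -> C) : C :=
  (real (Lim_seq (fun n => Re (u n))), real (Lim_seq (fun n => Im (u n)))).

Definition Cexp (z : C) : C :=
  (exp (Re z) * cos (Im z), exp (Re z) * sin (Im z)).

(* Principal value of x^z; meaningful for x > 0. *)
Definition Rcpow (x : R) (z : C) : C := Cexp (z * RtoC (ln x))%C.

(* The Dirichlet series, which is the Riemann zeta function on Re s > 1 only;
   the analytic continuation is not covered. *)
Definition zeta (s : C) : C :=
  Clim_seq (sum_n (fun n => Rcpow (INR (S n)) (- s)%C)).

(* rising z n = z (z + 1) ... (z + n), with n + 1 factors. *)
Fixpoint rising (z : C) (n : nat) : C :=
  match n with
  | O => z
  | S m => (rising z m * (z + RtoC (INR n)))%C
  end.

(* Euler's limit  n! n^z / (z (z + 1) ... (z + n)),  which converges to Gamma(z)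
   at every complex z other than 0, -1, -2, ...  The term n = 0 is irrelevant. *)
Definition Gamma (z : C) : C :=
  Clim_seq (fun n => (RtoC (INR (fact n)) * Rcpow (INR n) z / rising z n)%C).

(* C_derive is total, and is the complex derivative wherever that exists; Gamma is
   holomorphic and nonzero away from 0, -1, -2, ... *)
Definition digamma (z : C) : C := (C_derive Gamma z / Gamma z)%C.

Definition omega (k r : nat) : C :=
  Cexp (2 * RtoC PI * Ci * (RtoC (INR r) + 1 / 2) / RtoC (INR (2 * k + 1)))%C.

(* For w > 0 no argument - omega k r * w is a pole of digamma: it is real only
   for r = k modulo 2 k + 1, where it equals w. *)
Definition c (k : nat) (w : R) : C :=
  (1 / RtoC (INR (2 * k + 1)) *
   sum_n (fun r => omega k r * digamma (- omega k r * RtoC w))%C (2 * k))%C.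

(* Main.v *)
Require Import Defs.
From Stdlib Require Import Reals Factorial Lra Lia.
From Coquelicot Require Import Coquelicot.

Open Scope R_scope.

(** Put N = 2 k + 1.  The digamma function is the series
    psi(z) = sum_j (l_j - 1 / (z + j)), with l_j = ln j - ln (j - 1) for j >= 2
    and l_0 = l_1 = 0, since Gamma(z) is the limit of n! n^z / (z ... (z + n))
    and ln n = l_0 + ... + l_n.  In c_k(w) the arguments are - omega_r w, where
    the omega_r are the N roots of x^N = -1.  Averaging
    omega_r (l_j - 1 / (j - omega_r w)) over r kills l_j, because the omega_r add
    up to 0, and the partial fractions that remain recombine:
      c_k(w) = sum_(j >= 0) w^(2 k) / (j^N + w^N)      ([c_series]).
    Divide by w^(4 k + 1) at w = n.  The term j = 0 becomes 1 / n^(4 k + 2), and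
    these add up to zeta (4 k + 2).  The other terms form the double series of
    T(n, m) = 1 / (n^N (n^N + m^N)) over n, m >= 1.  Its terms are nonnegative and
    T(n, m) + T(m, n) = 1 / (n^N m^N), so its sum is half of zeta(N)^2
    ([symmetrised_double_series]).

    The work is in the digamma series ([digamma_cv]), because Gamma is a bare
    pointwise limit here.  The quotient of the n-th Euler approximations at z + t
    and at z is a finite product of factors
    exp(t l_j) (z + j) / (z + t + j) = 1 + t (l_j - 1 / (z + j)) + O(t^2 / (j + 1)^2),
    where l_j - 1 / (z + j) = O(1 / (j + 1)^2)  ([shift_factor_bound]).  This one
    expansion does everything.  For arbitrary t it makes the products converge;
    started at z = 1, where the approximation is n / (n + 1), it proves that the
    limit defining Gamma exists, and the product from z back to 1 is the inverse,
    so Gamma(z) is not 0 ([Gamma_cv]).  For small t it is a second-order expansion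
    uniform in n, which survives the limit and gives
    Gamma(z + t) = Gamma(z) (1 + t psi(z)) + O(t^2)  ([Gamma_taylor]). *)

(** * Complex limits and finite sums *)

(** Coordinatewise convergence reduces every limit law to the real one; it is also
    exactly what [Clim_seq] computes. *)
Definition Ccv (u : nat -> C) (l : C) : Prop :=
  is_lim_seq (fun n => Re (u n)) (Re l) /\ is_lim_seq (fun n => Im (u n)) (Im l).

Lemma Ccv_Clim_seq u l : Ccv u l -> Clim_seq u = l.
Proof.
  intros [Hr Hi]; unfold Clim_seq.
  rewrite (is_lim_seq_unique _ _ Hr), (is_lim_seq_unique _ _ Hi).
  now destruct l.
Qed.

Lemma Ccv_unique u l1 l2 : Ccv u l1 -> Ccv u l2 -> l1 = l2.
Proof.
  intros H1 H2; rewrite <- (Ccv_Clim_seq _ _ H1); now apply Ccv_Clim_seq.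
Qed.

Lemma Ccv_ext u v l : (forall n, u n = v n) -> Ccv u l -> Ccv v l.
Proof.
  intros E [Hr Hi]; split; [apply is_lim_seq_ext with (2 := Hr)
    | apply is_lim_seq_ext with (2 := Hi)]; intros n; now rewrite E.
Qed.

Lemma Ccv_const a : Ccv (fun _ => a) a.
Proof. split; apply is_lim_seq_const. Qed.

Lemma Ccv_RtoC (u : nat -> R) (l : R) :
  is_lim_seq u l -> Ccv (fun n => RtoC (u n)) (RtoC l).
Proof. intros H; split; [exact H | apply is_lim_seq_const]. Qed.

Lemma Ccv_real (u : nat -> R) (l : C) :
  Ccv (fun n => RtoC (u n)) l -> is_lim_seq u (Re l) /\ l = RtoC (Re l).
Proof.
  intros [Hr Hi]; split; [exact Hr |].
  apply is_lim_seq_unique in Hi; cbn [Im snd RtoC] in Hi; rewrite Lim_seq_const in Hi.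
  destruct l as [x y]; cbn in *; unfold RtoC; f_equal; congruence.
Qed.

Lemma Ccv_plus u v a b : Ccv u a -> Ccv v b -> Ccv (fun n => u n + v n)%C (a + b)%C.
Proof.
  intros [Hr Hi] [Kr Ki]; split; cbn; now apply is_lim_seq_plus'.
Qed.

Lemma Ccv_mult u v a b : Ccv u a -> Ccv v b -> Ccv (fun n => u n * v n)%C (a * b)%C.
Proof.
  intros [Hr Hi] [Kr Ki]; split; cbn.
  - apply is_lim_seq_minus'; now apply is_lim_seq_mult'.
  - apply is_lim_seq_plus'; now apply is_lim_seq_mult'.
Qed.

Lemma Ccv_scal a u l : Ccv u l -> Ccv (fun n => a * u n)%C (a * l)%C.
Proof. intros H; apply Ccv_mult; [apply Ccv_const | exact H]. Qed.

Lemma Ccv_incr_1 u l : Ccv (fun n => u (S n)) l -> Ccv u l.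
Proof.
  intros [Hr Hi]; split.
  - now apply is_lim_seq_incr_1.
  - now apply is_lim_seq_incr_1.
Qed.

Lemma csum_S (a : nat -> C) n : sum_n a (S n) = (sum_n a n + a (S n))%C.
Proof. exact (sum_Sn a n). Qed.

Lemma csum_0 (a : nat -> C) : sum_n a 0 = a 0%nat.
Proof. exact (sum_O a). Qed.

Lemma csum_ext (a b : nat -> C) n :
  (forall j, (j <= n)%nat -> a j = b j) -> sum_n a n = sum_n b n.
Proof. exact (sum_n_ext_loc a b n). Qed.

Lemma csum_scal (z : C) (a : nat -> C) n :
  sum_n (fun j => z * a j)%C n = (z * sum_n a n)%C.
Proof. exact (sum_n_mult_l z a n). Qed.

Lemma csum_plus (a b : nat -> C) n :
  sum_n (fun j => a j + b j)%C n = (sum_n a n + sum_n b n)%C.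
Proof. exact (sum_n_plus a b n). Qed.

Lemma rsum_S (a : nat -> R) n : sum_n a (S n) = sum_n a n + a (S n).
Proof. exact (sum_Sn a n). Qed.

Lemma rsum_0 (a : nat -> R) : sum_n a 0 = a 0%nat.
Proof. exact (sum_O a). Qed.

Lemma csum_RtoC (a : nat -> R) n :
  sum_n (fun j => RtoC (a j)) n = RtoC (sum_n a n).
Proof.
  induction n as [|n IH].
  - now rewrite csum_0, sum_O.
  - now rewrite csum_S, IH, rsum_S, RtoC_plus.
Qed.

Lemma Ccv_sum (u : nat -> nat -> C) (l : nat -> C) m :
  (forall r, (r <= m)%nat -> Ccv (u r) (l r)) ->
  Ccv (fun n => sum_n (fun r => u r n) m) (sum_n l m).
Proof.
  induction m as [|m IH]; intros H.
  - rewrite csum_0. apply Ccv_ext with (u 0%nat); [|now apply H].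
    intros n; now rewrite csum_0.
  - rewrite csum_S.
    apply Ccv_ext with (fun n => sum_n (fun r => u r n) m + u (S m) n)%C.
    + intros n; now rewrite csum_S.
    + apply Ccv_plus; [apply IH; intros r Hr | ]; apply H; lia.
Qed.

Lemma Ccv_filterlim (u : nat -> C) (l : C) :
  Ccv u l -> filterlim u eventually (locally (T := C_NormedModule) l).
Proof.
  intros [Hr Hi]; apply filterlim_locally; intros eps.
  apply is_lim_seq_spec in Hr; apply is_lim_seq_spec in Hi.
  generalize (filter_and _ _ (Hr eps) (Hi eps)).
  apply filter_imp; intros n [A B]; split; [exact A | exact B].
Qed.

(** Closed discs are closed: this carries the estimates on partial products over to
    their limits. *)
Lemma Ccv_Cmod_le u l a M :
  Ccv u l -> (forall n, Cmod (u n - a) <= M) -> Cmod (l - a) <= M.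
Proof.
  intros Hu HM.
  assert (H0 : 0 <= M) by (apply Rle_trans with (2 := HM 0%nat); apply Cmod_ge_0).
  destruct (Ccv_plus _ _ _ _ Hu (Ccv_const (- a)%C)) as [Hr Hi].
  apply Rsqr_incr_0_var; [| exact H0].
  rewrite Rsqr_pow2, Cmod2_alt, <- !Rsqr_pow2; unfold Rsqr.
  refine (is_lim_seq_le _ (fun _ => M * M) _ (Finite (M * M)) _
    (is_lim_seq_plus' _ _ _ _ (is_lim_seq_mult' _ _ _ _ Hr Hr)
       (is_lim_seq_mult' _ _ _ _ Hi Hi)) (is_lim_seq_const _)).
  intros n. generalize (Cmod2_alt (u n - a)) (HM n) (Cmod_ge_0 (u n - a)).
  unfold Cminus; cbn -[Cmod]; nra.
Qed.

(** Telescoping: the sequence is its first term plus an absolutely convergent series. *)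
Lemma is_lim_seq_summable_increments (u b : nat -> R) K :
  ex_series b -> (forall n, Rabs (u (S n) - u n) <= K * b n) ->
  exists l : R, is_lim_seq u l.
Proof.
  intros Hb Hu.
  assert (Hex : ex_series (fun n => u (S n) - u n)).
  { apply (ex_series_le (K := R_AbsRing) (V := R_CompleteNormedModule)
      _ (fun n => K * b n)); [exact Hu |].
    exact (ex_series_scal_l K b Hb). }
  destruct Hex as [l Hl]; exists (l + u 0%nat).
  apply is_lim_seq_incr_1.
  apply is_lim_seq_ext with (fun n => sum_n (fun j => u (S j) - u j) n + u 0%nat).
  - intros n; induction n as [|n IH]; [rewrite sum_O; ring |].
    rewrite rsum_S; lra.
  - apply is_lim_seq_plus'; [exact Hl | apply is_lim_seq_const].
Qed.

Lemma Ccv_summable_increments (u : nat -> C) (b : nat -> R) K :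
  ex_series b -> (forall n, Cmod (u (S n) - u n) <= K * b n) ->
  exists l : C, Ccv u l.
Proof.
  intros Hb Hu.
  destruct (is_lim_seq_summable_increments (fun n => Re (u n)) b K Hb) as [x Hx].
  { intros n; apply Rle_trans with (2 := Hu n).
    apply Rle_trans with (2 := re_le_Cmod _); right; reflexivity. }
  destruct (is_lim_seq_summable_increments (fun n => Im (u n)) b K Hb) as [y Hy].
  { intros n; apply Rle_trans with (2 := Hu n).
    apply Rle_trans with (2 := Rmax_Cmod _).
    apply Rle_trans with (2 := Rmax_r _ _); right; reflexivity. }
  exists (x, y); split; assumption.
Qed.

Lemma exp_le x y : x <= y -> exp x <= exp y.
Proof. intros [H | ->]; [left; now apply exp_increasing | apply Rle_refl]. Qed.

Lemma exp_minus_1_bound a : Rabs (exp a - 1) <= Rabs a * exp (Rabs a).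
Proof.
  destruct (MVT_gen exp 0 a exp) as [x [Hx E]].
  - intros x _; apply is_derive_exp.
  - intros x _; apply derivable_continuous_pt, derivable_pt_exp.
  - rewrite exp_0 in E; rewrite E, Rminus_0_r, Rabs_mult, Rmult_comm.
    apply Rmult_le_compat_l; [apply Rabs_pos |].
    rewrite Rabs_pos_eq by (left; apply exp_pos).
    apply exp_le. unfold Rmin, Rmax in Hx; unfold Rabs.
    destruct (Rle_dec 0 a), (Rcase_abs a); lra.
Qed.

Lemma exp_taylor_bound a : Rabs (exp a - 1 - a) <= Rabs a ^ 2 * exp (Rabs a).
Proof.
  destruct (MVT_gen (fun x => exp x - x) 0 a (fun x => exp x - 1)) as [x [Hx E]].
  - intros x _; auto_derive; [easy | ring].
  - intros x _; apply continuity_pt_filterlim.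
    apply (ex_derive_continuous (fun x => exp x - x)). auto_derive; easy.
  - rewrite exp_0 in E.
    replace (exp a - 1 - a) with ((exp x - 1) * a) by lra.
    assert (Hxa : Rabs x <= Rabs a).
    { unfold Rmin, Rmax in Hx; unfold Rabs.
      destruct (Rle_dec 0 a), (Rcase_abs a), (Rcase_abs x); lra. }
    rewrite Rabs_mult.
    replace (Rabs a ^ 2 * exp (Rabs a)) with (Rabs a * exp (Rabs a) * Rabs a) by ring.
    apply Rmult_le_compat_r; [apply Rabs_pos |].
    apply Rle_trans with (1 := exp_minus_1_bound x).
    apply Rmult_le_compat; auto using Rabs_pos, exp_le, Rlt_le, exp_pos.
Qed.

Lemma Rabs_sin_le b : Rabs (sin b) <= Rabs b.
Proof.
  destruct (MVT_gen sin 0 b cos) as [x [_ E]].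
  - intros x _; apply is_derive_sin.
  - intros x _; apply continuity_sin.
  - rewrite sin_0, !Rminus_0_r in E; rewrite E, Rabs_mult.
    rewrite <- (Rmult_1_l (Rabs b)) at 2.
    apply Rmult_le_compat_r; [apply Rabs_pos |].
    apply Rabs_le; apply COS_bound.
Qed.

Lemma cos_taylor_bound b : Rabs (cos b - 1) <= Rabs b ^ 2.
Proof.
  destruct (MVT_gen cos 0 b (fun x => - sin x)) as [x [Hx E]].
  - intros x _; apply is_derive_cos.
  - intros x _; apply continuity_cos.
  - rewrite cos_0, !Rminus_0_r in E; rewrite E, Rabs_mult, Rabs_Ropp.
    replace (Rabs b ^ 2) with (Rabs b * Rabs b) by ring.
    apply Rmult_le_compat_r; [apply Rabs_pos |].
    apply Rle_trans with (1 := Rabs_sin_le x).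
    unfold Rmin, Rmax in Hx; unfold Rabs.
    destruct (Rle_dec 0 b), (Rcase_abs b), (Rcase_abs x); lra.
Qed.

Lemma cos_lipschitz_bound b : Rabs (cos b - 1) <= Rabs b.
Proof.
  destruct (MVT_gen cos 0 b (fun x => - sin x)) as [x [Hx E]].
  - intros x _; apply is_derive_cos.
  - intros x _; apply continuity_cos.
  - rewrite cos_0, !Rminus_0_r in E; rewrite E, Rabs_mult, Rabs_Ropp.
    rewrite <- (Rmult_1_l (Rabs b)) at 2.
    apply Rmult_le_compat_r; [apply Rabs_pos |].
    apply Rabs_le; apply SIN_bound.
Qed.

Lemma sin_taylor_bound b : Rabs (sin b - b) <= Rabs b ^ 2.
Proof.
  destruct (MVT_gen (fun x => sin x - x) 0 b (fun x => cos x - 1)) as [x [Hx E]].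
  - intros x _; auto_derive; [easy | ring].
  - intros x _; apply continuity_pt_filterlim.
    apply (ex_derive_continuous (fun x => sin x - x)). auto_derive; easy.
  - rewrite sin_0, !Rminus_0_r in E; rewrite E, Rabs_mult.
    replace (Rabs b ^ 2) with (Rabs b * Rabs b) by ring.
    apply Rmult_le_compat_r; [apply Rabs_pos |].
    apply Rle_trans with (1 := cos_lipschitz_bound x).
    unfold Rmin, Rmax in Hx; unfold Rabs.
    destruct (Rle_dec 0 b), (Rcase_abs b), (Rcase_abs x); lra.
Qed.

Lemma Cmod_le_Re_Im z : Cmod z <= Rabs (Re z) + Rabs (Im z).
Proof.
  apply Rsqr_incr_0_var.
  - rewrite Rsqr_pow2, Cmod2_alt.
    rewrite <- (pow2_abs (Re z)), <- (pow2_abs (Im z)); unfold Rsqr.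
    generalize (Rabs_pos (Re z)) (Rabs_pos (Im z)); nra.
  - generalize (Rabs_pos (Re z)) (Rabs_pos (Im z)); lra.
Qed.

Lemma im_le_Cmod z : Rabs (Im z) <= Cmod z.
Proof. exact (Rle_trans _ _ _ (Rmax_r _ _) (Rmax_Cmod z)). Qed.

(** Both coordinates split into real Taylor remainders:
    e^a cos b - 1 - a = e^a (cos b - 1) + (e^a - 1 - a) and
    e^a sin b - b = e^a (sin b - b) + (e^a - 1) b.  The constant is not sharp. *)
Lemma Cexp_taylor_bound u :
  Cmod (Cexp u - 1 - u) <= 5 * Cmod u ^ 2 * exp (Cmod u).
Proof.
  destruct u as [a b].
  generalize (re_le_Cmod (a, b)) (im_le_Cmod (a, b)); cbn [Re Im fst snd].
  set (m := Cmod (a, b)); intros Ha Hb.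
  assert (Em : exp (Rabs a) <= exp m) by now apply exp_le.
  assert (Ea : exp a <= exp m).
  { apply Rle_trans with (2 := Em), exp_le, Rle_abs. }
  generalize (exp_pos a) (Rabs_pos a) (Rabs_pos b); intros P Pa Pb.
  assert (B2 : Rabs b ^ 2 <= m ^ 2) by (apply pow_incr; lra).
  assert (A2 : Rabs a ^ 2 <= m ^ 2) by (apply pow_incr; lra).
  assert (Q : 0 <= m ^ 2) by apply pow2_ge_0.
  apply Rle_trans with (1 := Cmod_le_Re_Im _).
  cbn -[exp cos sin pow].
  assert (R1 : Rabs (exp a * cos b - 1 - a) <= 2 * m ^ 2 * exp m).
  { replace (exp a * cos b - 1 - a)
      with (exp a * (cos b - 1) + (exp a - 1 - a)) by ring.
    apply Rle_trans with (1 := Rabs_triang _ _).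
    rewrite Rabs_mult, (Rabs_pos_eq (exp a)) by lra.
    generalize (cos_taylor_bound b) (exp_taylor_bound a); intros H1 H2.
    assert (exp a * Rabs (cos b - 1) <= exp m * m ^ 2).
    { apply Rmult_le_compat; try lra; apply Rabs_pos. }
    assert (Rabs a ^ 2 * exp (Rabs a) <= m ^ 2 * exp m).
    { apply Rmult_le_compat; try lra; [apply pow2_ge_0 | left; apply exp_pos]. }
    lra. }
  assert (R2 : Rabs (exp a * sin b - b) <= 2 * m ^ 2 * exp m).
  { replace (exp a * sin b - b)
      with (exp a * (sin b - b) + (exp a - 1) * b) by ring.
    apply Rle_trans with (1 := Rabs_triang _ _).
    rewrite !Rabs_mult, (Rabs_pos_eq (exp a)) by lra.
    generalize (sin_taylor_bound b) (exp_minus_1_bound a); intros H1 H2.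
    assert (exp a * Rabs (sin b - b) <= exp m * m ^ 2).
    { apply Rmult_le_compat; try lra; apply Rabs_pos. }
    assert (Rabs (exp a - 1) * Rabs b <= m * exp m * m).
    { apply Rmult_le_compat; try lra; try apply Rabs_pos.
      apply Rle_trans with (1 := H2).
      apply Rmult_le_compat; try lra. left; apply exp_pos. }
    replace (m ^ 2) with (m * m) in * by ring. lra. }
  replace (exp a * cos b + - (1) + - a) with (exp a * cos b - 1 - a) by ring.
  replace (exp a * sin b + - 0 + - b) with (exp a * sin b - b) by ring.
  assert (0 <= m ^ 2 * exp m) by (apply Rmult_le_pos; [lra | left; apply exp_pos]).
  lra.
Qed.

Lemma Cexp_plus u v : Cexp (u + v) = (Cexp u * Cexp v)%C.
Proof.
  destruct u as [a b], v as [c d]; unfold Cexp, Cmult; cbn [Re Im fst snd Cplus].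
  rewrite exp_plus, cos_plus, sin_plus; f_equal; ring.
Qed.

Lemma Cexp_0 : Cexp 0 = 1.
Proof. unfold Cexp; cbn; now rewrite exp_0, cos_0, sin_0, Rmult_1_l, Rmult_0_r. Qed.

Lemma Cexp_pow u n : (Cexp u ^ n)%C = Cexp (RtoC (INR n) * u).
Proof.
  induction n as [|n IH].
  - cbn [Cpow INR]; rewrite Cmult_0_l; now rewrite Cexp_0.
  - rewrite Cpow_S, IH, <- Cexp_plus, S_INR, RtoC_plus; f_equal; ring.
Qed.

(** * Infinite products with factors close to 1 *)

Fixpoint cprod (f : nat -> C) (n : nat) : C :=
  match n with
  | O => f 0%nat
  | S m => (cprod f m * f (S m))%C
  end.

Lemma rsum_pos (beta : nat -> R) n : (forall j, 0 <= beta j) -> 0 <= sum_n beta n.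
Proof.
  intros beta_pos; induction n as [|n IH]; [rewrite rsum_0; apply beta_pos |].
  rewrite rsum_S; generalize (beta_pos (S n)); lra.
Qed.

(** Each factor is at most 1 + A beta_j, hence at most exp (A beta_j). *)
Lemma cprod_bound (f : nat -> C) (beta : nat -> R) A :
  0 <= A -> (forall j, Cmod (f j - 1) <= A * beta j) ->
  forall n, Cmod (cprod f n) <= exp (A * sum_n beta n).
Proof.
  intros HA Hf.
  assert (Hfac : forall j, Cmod (f j) <= exp (A * beta j)).
  { intros j; apply Rle_trans with (2 := exp_ineq1_le _).
    replace (f j) with (1 + (f j - 1))%C by ring.
    apply Rle_trans with (1 := Cmod_triangle _ _).
    rewrite Cmod_1; generalize (Hf j); lra. }
  induction n as [|n IH].
  - rewrite rsum_0; apply Hfac.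
  - rewrite rsum_S, Rmult_plus_distr_l, exp_plus; cbn [cprod].
    rewrite Cmod_mult; apply Rmult_le_compat; auto using Cmod_ge_0.
Qed.

Lemma cprod_bound_unif (f : nat -> C) (beta : nat -> R) Sb A :
  (forall n, sum_n beta n <= Sb) -> 0 <= A -> (forall j, Cmod (f j - 1) <= A * beta j) ->
  forall n, Cmod (cprod f n) <= exp (A * Sb).
Proof.
  intros sum_le HA Hf n; apply Rle_trans with (1 := cprod_bound f beta A HA Hf n).
  apply exp_le, Rmult_le_compat_l; auto.
Qed.

(** The increments P_(n+1) - P_n = P_n (f_(n+1) - 1) are of order tau because the
    partial products are uniformly bounded. *)
Lemma cprod_minus_1_bound (f : nat -> C) (beta : nat -> R) Sb A tau :
  (forall j, 0 <= beta j) -> (forall n, sum_n beta n <= Sb) ->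
  0 <= A -> 0 <= tau <= 1 -> (forall j, Cmod (f j - 1) <= tau * A * beta j) ->
  forall n, Cmod (cprod f n - 1) <= tau * A * exp (A * Sb) * sum_n beta n.
Proof.
  intros beta_pos sum_le HA Ht Hf.
  assert (HS : 0 <= Sb) by (apply Rle_trans with (2 := sum_le 0%nat); now apply rsum_pos).
  assert (Hf' : forall j, Cmod (f j - 1) <= A * beta j).
  { intros j; apply Rle_trans with (1 := Hf j).
    apply Rmult_le_compat_r; [apply beta_pos | nra]. }
  assert (E1 : 1 <= exp (A * Sb)).
  { rewrite <- exp_0; apply exp_le; now apply Rmult_le_pos. }
  assert (HtA : 0 <= tau * A) by (apply Rmult_le_pos; lra).
  induction n as [|n IH].
  - rewrite rsum_0; cbn [cprod]; apply Rle_trans with (1 := Hf _).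
    apply Rmult_le_compat_r; [apply beta_pos | nra].
  - rewrite rsum_S; cbn [cprod].
    replace (cprod f n * f (S n) - 1)%C
      with ((cprod f n - 1) + cprod f n * (f (S n) - 1))%C by ring.
    apply Rle_trans with (1 := Cmod_triangle _ _).
    rewrite Cmod_mult, Rmult_plus_distr_l; apply Rplus_le_compat; [exact IH |].
    rewrite (Rmult_comm (tau * A)), Rmult_assoc.
    apply Rmult_le_compat;
      eauto using Cmod_ge_0, cprod_bound_unif.
Qed.

(** The point is that the error is quadratic in t with a constant free of n, so the
    estimate passes to infinite products.  Going from n to n + 1 adds
    (P_n - 1) (f - 1), a product of two terms of order t, and the remainder of the
    new factor. *)
Lemma cprod_second_order (f : nat -> C) (beta : nat -> R) Sb (b : nat -> C) (t : C) B K :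
  (forall j, 0 <= beta j) -> (forall n, sum_n beta n <= Sb) ->
  0 <= B -> 0 <= K -> Cmod t <= 1 ->
  (forall j, Cmod (b j) <= B * beta j) ->
  (forall j, Cmod (f j - 1 - t * b j) <= Cmod t ^ 2 * K * beta j) ->
  let A := B + K in
  forall n, Cmod (cprod f n - 1 - t * sum_n b n)
    <= Cmod t ^ 2 * ((A * A * exp (A * Sb) * Sb + K) * Sb).
Proof.
  intros beta_pos sum_le HB HK Ht Hb Hf A n.
  assert (HS : 0 <= Sb) by (apply Rle_trans with (2 := sum_le 0%nat); now apply rsum_pos).
  generalize (Cmod_ge_0 t); intros Ht0.
  assert (HA : 0 <= A) by (unfold A; lra).
  assert (Hf1 : forall j, Cmod (f j - 1) <= Cmod t * A * beta j).
  { intros j; replace (f j - 1)%C with ((f j - 1 - t * b j) + t * b j)%C by ring.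
    apply Rle_trans with (1 := Cmod_triangle _ _).
    rewrite Cmod_mult.
    assert (Cmod t * Cmod (b j) <= Cmod t * (B * beta j))
      by (apply Rmult_le_compat_l; auto).
    assert (Cmod t ^ 2 * K * beta j <= Cmod t * K * beta j).
    { apply Rmult_le_compat_r; [apply beta_pos |].
      apply Rmult_le_compat_r; [exact HK | nra]. }
    generalize (Hf j); unfold A; nra. }
  assert (E0 : 0 < exp (A * Sb)) by apply exp_pos.
  assert (HL : 0 <= A * A * exp (A * Sb) * Sb) by
    (repeat apply Rmult_le_pos; auto; lra).
  (* The induction goes through with the partial sum of beta in place of its bound. *)
  apply Rle_trans with
    (Cmod t ^ 2 * ((A * A * exp (A * Sb) * Sb + K) * sum_n beta n)).
  2: { apply Rmult_le_compat_l; [apply pow2_ge_0 |].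
       apply Rmult_le_compat_l; [lra | apply sum_le]. }
  induction n as [|n IH].
  - rewrite rsum_0, csum_0; cbn [cprod]; apply Rle_trans with (1 := Hf _).
    rewrite Rmult_assoc; apply Rmult_le_compat_l; [apply pow2_ge_0 |].
    apply Rmult_le_compat_r; [apply beta_pos | lra].
  - rewrite rsum_S, csum_S; cbn [cprod].
    replace (cprod f n * f (S n) - 1 - t * (sum_n b n + b (S n)))%C
      with ((cprod f n - 1 - t * sum_n b n)
        + ((cprod f n - 1) * (f (S n) - 1) + (f (S n) - 1 - t * b (S n))))%C by ring.
    apply Rle_trans with (1 := Cmod_triangle _ _).
    rewrite !Rmult_plus_distr_l; apply Rplus_le_compat;
      [exact IH |].
    apply Rle_trans with (1 := Cmod_triangle _ _).
    rewrite Cmod_mult.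
    assert (Hp : Cmod (cprod f n - 1) <= Cmod t * A * exp (A * Sb) * Sb).
    { apply Rle_trans with
        (1 := cprod_minus_1_bound f beta Sb A _ beta_pos sum_le HA (conj Ht0 Ht) Hf1 n).
      apply Rmult_le_compat_l; [| apply sum_le].
      repeat apply Rmult_le_pos; lra. }
    rewrite Rmult_plus_distr_r, Rmult_plus_distr_l; apply Rplus_le_compat.
    + replace (Cmod t ^ 2 * (A * A * exp (A * Sb) * Sb * beta (S n)))
        with ((Cmod t * A * exp (A * Sb) * Sb) * (Cmod t * A * beta (S n))) by ring.
      apply Rmult_le_compat; auto using Cmod_ge_0.
    + apply Rle_trans with (1 := Hf (S n)); right; ring.
Qed.

(** The increments P_n (f_(n+1) - 1) are summable, as P_n stays bounded. *)
Lemma cprod_cv (f : nat -> C) (beta : nat -> R) Sb A :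
  (forall n, sum_n beta n <= Sb) -> 0 <= A -> ex_series beta ->
  (forall j, Cmod (f j - 1) <= A * beta j) -> exists l, Ccv (cprod f) l.
Proof.
  intros sum_le HA Hex Hf.
  apply (Ccv_summable_increments _ (fun n => beta (S n)) (exp (A * Sb) * A)).
  - now apply (ex_series_incr_1 beta).
  - intros n; cbn [cprod].
    replace (cprod f n * f (S n) - cprod f n)%C
      with (cprod f n * (f (S n) - 1))%C by ring.
    rewrite Cmod_mult, Rmult_assoc.
    apply Rmult_le_compat;
      eauto using Cmod_ge_0, cprod_bound_unif.
Qed.

(** The majorant for all series and products below.  The shift by 1 makes it finite
    at j = 0, so that no index needs separate treatment. *)
Definition inv_sq (j : nat) : R := / (INR j + 1) ^ 2.

Lemma INR1_ge j : 1 <= INR j + 1.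
Proof. generalize (pos_INR j); lra. Qed.

Lemma inv_sq_pos j : 0 <= inv_sq j.
Proof.
  left; apply Rinv_0_lt_compat, pow_lt; generalize (INR1_ge j); lra.
Qed.

(** Induction needs the sharper bound 2 - 1 / (n + 1), whose increments
    1 / (x (x + 1)), with x = n + 1, dominate 1 / (x + 1)^2. *)
Lemma sum_inv_sq_le n : sum_n inv_sq n <= 2.
Proof.
  apply Rle_trans with (2 - / (INR n + 1)).
  2: { assert (0 < / (INR n + 1)); [|lra].
       apply Rinv_0_lt_compat; generalize (INR1_ge n); lra. }
  induction n as [|n IH].
  - rewrite rsum_0; unfold inv_sq; cbn [INR]. right; field.
  - rewrite rsum_S; unfold inv_sq at 2; rewrite S_INR.
    generalize (INR1_ge n); set (x := INR n + 1) in *; intros Hx.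
    assert (/ (x + 1) ^ 2 <= / x - / (x + 1)); [|lra].
    replace (/ x - / (x + 1)) with (/ (x * (x + 1))) by (field; lra).
    apply Rinv_le_contravar; [apply Rmult_lt_0_compat; lra | nra].
Qed.

Lemma ex_series_bounded (a : nat -> R) M :
  (forall n, 0 <= a n) -> (forall n, sum_n a n <= M) -> ex_series a.
Proof.
  intros Ha HM.
  destruct (ex_finite_lim_seq_incr (sum_n a) M) as [l Hl].
  - intros n; rewrite rsum_S; generalize (Ha (S n)); lra.
  - exact HM.
  - exists l; exact Hl.
Qed.

Lemma ex_series_inv_sq : ex_series inv_sq.
Proof. exact (ex_series_bounded _ _ inv_sq_pos sum_inv_sq_le). Qed.

(** * Convergence of Euler's product for Gamma *)

(** Since [ln 0] is 0 and [pred 0] is 0, the terms of index 0 and 1 vanish.  Hence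
    the sum up to n is ln n for every n, including n = 0, and each factor z + j of
    [rising z n] is paired with one factor of n^z. *)
Definition log_step (j : nat) : R := ln (INR j) - ln (INR (pred j)).

Lemma ln_0 : ln 0 = 0.
Proof.
  unfold ln; destruct (Rlt_dec 0 0) as [H |]; [elim (Rlt_irrefl 0 H) | reflexivity].
Qed.

Lemma sum_log_step n : sum_n log_step n = ln (INR n) :> R.
Proof.
  induction n as [|n IH].
  - rewrite rsum_0; unfold log_step; cbn [pred INR]; rewrite ln_0; ring.
  - rewrite rsum_S, IH; unfold log_step; cbn [pred]; ring.
Qed.

Lemma ln_le_minus_1 x : 0 < x -> ln x <= x - 1.
Proof.
  intros Hx; generalize (exp_ineq1_le (ln x)); rewrite exp_ln by exact Hx; lra.
Qed.

(** For j >= 2, 1 / j <= ln j - ln (j - 1) <= 1 / (j - 1), and the distance from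
    1 / (j - 1) to 1 / (j + 1) is of order 1 / j^2. *)
Lemma log_step_bound j : Rabs (log_step j - / (INR j + 1)) <= 6 * inv_sq j.
Proof.
  unfold inv_sq, log_step; destruct j as [|[|j]]; cbn [pred].
  - cbn [INR]; rewrite ln_0; replace (0 - 0 - / (0 + 1)) with (-(1)) by field.
    rewrite Rabs_Ropp, Rabs_R1; lra.
  - cbn [INR]; rewrite ln_0, ln_1; rewrite Rabs_left; lra.
  - rewrite !S_INR; generalize (INR1_ge j); set (x := INR j + 1); intros Hx.
    assert (L1 : ln (x + 1) - ln x <= / x).
    { rewrite <- ln_div by lra.
      eapply Rle_trans; [apply ln_le_minus_1, Rdiv_lt_0_compat; lra |].
      right; field; lra. }
    assert (L2 : / (x + 1) <= ln (x + 1) - ln x).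
    { assert (ln x - ln (x + 1) <= - / (x + 1)); [|lra].
      rewrite <- ln_div by lra.
      eapply Rle_trans; [apply ln_le_minus_1, Rdiv_lt_0_compat; lra |].
      right; field; lra. }
    assert (L3 : / (x + 1 + 1) <= / (x + 1)) by (apply Rinv_le_contravar; lra).
    rewrite Rabs_pos_eq by lra.
    apply Rle_trans with (/ x - / (x + 1 + 1)); [lra |].
    replace (/ x - / (x + 1 + 1)) with (2 * / (x * (x + 2))) by (field; lra).
    apply Rle_trans with (2 * (3 * / (x + 1 + 1) ^ 2)); [|lra].
    apply Rmult_le_compat_l; [lra |].
    apply Rmult_le_reg_l with (x * (x + 2) * (x + 1 + 1) ^ 2).
    { apply Rmult_lt_0_compat; [nra | apply pow_lt; lra]. }
    field_simplify; [nra | lra | lra].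
Qed.

Definition nonpole (z : C) : Prop := forall j : nat, (z + RtoC (INR j))%C <> 0.

(** Quantitative form of avoiding the poles.  A linear lower bound is what makes
    1 / (z + j) of order 1 / (j + 1) uniformly for points close to z. *)
Definition bounded_away (rho : R) (z : C) : Prop :=
  forall j : nat, rho * (INR j + 1) <= Cmod (z + RtoC (INR j)).

Lemma bounded_away_nonpole rho z : 0 < rho -> bounded_away rho z -> nonpole z.
Proof.
  intros Hc H j E; generalize (H j) (INR1_ge j); rewrite E, Cmod_0; nra.
Qed.

Lemma finitely_many_positive (a : nat -> R) n :
  (forall j, 0 < a j) -> exists rho, 0 < rho /\ forall j, (j < n)%nat -> rho <= a j.
Proof.
  intros Ha; induction n as [|n [rho [Hc IH]]].
  - exists 1; split; [lra | intros j Hj; lia].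
  - exists (Rmin rho (a n)); split; [now apply Rmin_glb_lt |].
    intros j Hj; destruct (Nat.eq_dec j n) as [-> | Hne]; [apply Rmin_r |].
    apply Rle_trans with (1 := Rmin_l _ _), IH; lia.
Qed.

(** From some j on, |z + j| >= j - |z| is at least half of j + 1; the finitely many
    other indices contribute a positive minimum. *)
Lemma nonpole_bounded_away z : nonpole z -> exists rho, 0 < rho /\ bounded_away rho z.
Proof.
  intros Hz.
  assert (Hpos : forall j, 0 < Cmod (z + RtoC (INR j)) / (INR j + 1)).
  { intros j; apply Rdiv_lt_0_compat; [now apply Cmod_gt_0, Hz |].
    generalize (INR1_ge j); lra. }
  destruct (INR_unbounded (2 * Cmod z + 1)) as [n Hn].
  destruct (finitely_many_positive _ n Hpos) as [rho [Hc Hsmall]].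
  exists (Rmin rho (/ 2)); split; [apply Rmin_glb_lt; lra |].
  intros j; generalize (INR1_ge j); intros Hj.
  destruct (Nat.lt_ge_cases j n) as [Hlt | Hge].
  - apply Rle_trans with (rho * (INR j + 1)).
    { apply Rmult_le_compat_r; [lra | apply Rmin_l]. }
    apply Rle_trans with (Cmod (z + RtoC (INR j)) / (INR j + 1) * (INR j + 1)).
    { apply Rmult_le_compat_r; [lra | now apply Hsmall]. }
    right; field; lra.
  - apply Rle_trans with (/ 2 * (INR j + 1)).
    { apply Rmult_le_compat_r; [lra | apply Rmin_r]. }
    apply le_INR in Hge.
    assert (T : INR j <= Cmod (z + RtoC (INR j)) + Cmod z).
    { rewrite <- (Rabs_pos_eq (INR j)) at 1 by apply pos_INR.
      rewrite <- Cmod_R, <- (Cmod_opp z).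
      replace (RtoC (INR j)) with ((z + RtoC (INR j)) + - z)%C at 1 by ring.
      apply Cmod_triangle. }
    lra.
Qed.

Lemma bounded_away_perturb rho z t :
  bounded_away rho z -> Cmod t <= rho / 2 -> bounded_away (rho / 2) (z + t).
Proof.
  intros H Ht j; generalize (H j) (INR1_ge j) (Cmod_ge_0 t); intros Hz Hj Ht0.
  assert (T : Cmod (z + RtoC (INR j)) <= Cmod (z + t + RtoC (INR j)) + Cmod t).
  { rewrite <- (Cmod_opp t).
    replace (z + RtoC (INR j))%C with ((z + t + RtoC (INR j)) + - t)%C by ring.
    apply Cmod_triangle. }
  nra.
Qed.

Definition euler (z : C) (n : nat) : C :=
  (RtoC (INR (fact n)) * Rcpow (INR n) z / rising z n)%C.

(** The factor of index j in the quotient of the Euler approximations at z + t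
    and at z. *)
Definition shift_factor (z t : C) (j : nat) : C :=
  (Cexp (t * RtoC (log_step j)) * (z + RtoC (INR j)) / (z + t + RtoC (INR j)))%C.

Lemma rising_neq_0 z n : nonpole z -> rising z n <> 0.
Proof.
  intros Hz; induction n as [|n IH]; cbn [rising].
  - intros E; apply (Hz 0%nat); rewrite E; cbn [INR]; ring.
  - apply Cmult_neq_0; [exact IH | apply Hz].
Qed.

Lemma Rcpow_plus x u v : Rcpow x (u + v) = (Rcpow x u * Rcpow x v)%C.
Proof. unfold Rcpow; rewrite <- Cexp_plus; f_equal; ring. Qed.

Lemma cprod_shift_factor z t n : nonpole z -> nonpole (z + t) ->
  cprod (shift_factor z t) n = (Rcpow (INR n) t * rising z n / rising (z + t) n)%C.
Proof.
  intros Hz Hzt.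
  assert (Hr : forall m, rising (z + t) m <> 0) by (intros m; now apply rising_neq_0).
  induction n as [|n IH].
  - cbn [cprod rising]; unfold shift_factor, Rcpow.
    change (log_step 0) with (ln (INR 0) - ln (INR 0)); rewrite Rminus_diag.
    cbn [INR]; rewrite ln_0, !Cplus_0_r; reflexivity.
  - cbn [cprod rising]; rewrite IH; unfold shift_factor.
    assert (E : Rcpow (INR (S n)) t
      = (Rcpow (INR n) t * Cexp (t * RtoC (log_step (S n))))%C).
    { unfold Rcpow; rewrite <- Cexp_plus; f_equal.
      rewrite <- !sum_log_step, rsum_S, RtoC_plus; ring. }
    rewrite E; field; split; [apply Hzt | apply Hr].
Qed.

Lemma euler_shift z t n : nonpole z -> nonpole (z + t) ->
  euler (z + t) n = (euler z n * cprod (shift_factor z t) n)%C.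
Proof.
  intros Hz Hzt; rewrite cprod_shift_factor by assumption.
  unfold euler; rewrite Rcpow_plus; field; split; now apply rising_neq_0.
Qed.

(** The terms of the digamma series, and the derivative at t = 0 of
    [shift_factor z t j]. *)
Definition log_increment (z : C) (j : nat) : C :=
  (RtoC (log_step j) - / (z + RtoC (INR j)))%C.

Lemma bounded_away_inv rho z j : 0 < rho -> bounded_away rho z ->
  Cmod (/ (z + RtoC (INR j))) <= / rho * / (INR j + 1).
Proof.
  intros Hc H; generalize (INR1_ge j); intros Hj.
  rewrite Cmod_inv by (now apply (bounded_away_nonpole rho)).
  rewrite <- Rinv_mult.
  apply Rinv_le_contravar; [nra | apply H].
Qed.

Lemma inv_sq_sqr j : inv_sq j = / (INR j + 1) * / (INR j + 1).
Proof. unfold inv_sq; generalize (INR1_ge j); intros; field; lra. Qed.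

Lemma inv_INR1 j : 0 < / (INR j + 1) <= 1.
Proof.
  generalize (INR1_ge j); intros Hj; split; [apply Rinv_0_lt_compat; lra |].
  rewrite <- Rinv_1; apply Rinv_le_contravar; lra.
Qed.

Lemma Cmod_log_step_le j : Cmod (RtoC (log_step j)) <= 7 * / (INR j + 1).
Proof.
  rewrite Cmod_R; generalize (log_step_bound j) (inv_INR1 j); rewrite inv_sq_sqr.
  set (q := / (INR j + 1)); intros H Hq.
  replace (log_step j) with ((log_step j - q) + q) by ring.
  apply Rle_trans with (1 := Rabs_triang _ _).
  rewrite (Rabs_pos_eq q) by lra; nra.
Qed.

(** Both [log_step j] and 1 / (z + j) differ from 1 / (j + 1) by O(1 / (j + 1)^2). *)
Lemma log_increment_bound rho z : 0 < rho -> bounded_away rho z ->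
  forall j, Cmod (log_increment z j) <= (6 + Cmod (z - 1) * / rho) * inv_sq j.
Proof.
  intros Hc H j; unfold log_increment.
  generalize (INR1_ge j); intros Hj.
  assert (Hz : (z + RtoC (INR j))%C <> 0) by now apply (bounded_away_nonpole rho).
  assert (HR : RtoC (INR j + 1) <> 0) by (intros E; apply RtoC_inj in E; lra).
  replace (RtoC (log_step j) - / (z + RtoC (INR j)))%C
    with (RtoC (log_step j - / (INR j + 1))
          + (z - 1) * (RtoC (/ (INR j + 1)) * / (z + RtoC (INR j))))%C.
  2: { rewrite RtoC_minus, RtoC_inv, RtoC_plus by lra; rewrite RtoC_plus in HR.
       field; split; assumption. }
  apply Rle_trans with (1 := Cmod_triangle _ _).
  rewrite !Cmod_mult, !Cmod_R, Rmult_plus_distr_r; apply Rplus_le_compat.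
  - apply log_step_bound.
  - rewrite Rmult_assoc; apply Rmult_le_compat_l; [apply Cmod_ge_0 |].
    generalize (bounded_away_inv rho z j Hc H) (inv_INR1 j).
    rewrite inv_sq_sqr; set (q := / (INR j + 1)); intros H1 H2.
    rewrite (Rabs_pos_eq q) by lra.
    rewrite Rmult_comm, <- Rmult_assoc; apply Rmult_le_compat_r; lra.
Qed.

(** With s = 1 / (z + j), l = [log_step j] and E = exp (t l), the factor is
    E / (1 + t s), and
    E / (1 + t s) - 1 - t (l - s) = ((E - 1 - t l) - t^2 s (l - s)) / (1 + t s).
    Both l and s are O(1 / (j + 1)), so the numerator is O(t^2 / (j + 1)^2).  The
    constant K depends only on rho and T, which gives uniformity near z. *)
Lemma shift_factor_bound rho T : 0 < rho -> 0 <= T -> exists K, 0 <= K /\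
  forall z t j, bounded_away rho z -> bounded_away rho (z + t) -> Cmod t <= T ->
  Cmod (shift_factor z t j - 1 - t * log_increment z j) <= Cmod t ^ 2 * K * inv_sq j.
Proof.
  intros Hc HT.
  assert (Hc' : 0 < / rho) by now apply Rinv_0_lt_compat.
  set (K1 := 5 * 49 * exp (7 * T)); set (K2 := / rho * (7 + / rho)).
  assert (HK1 : 0 < K1).
  { unfold K1; apply Rmult_lt_0_compat; [lra | apply exp_pos]. }
  assert (HK2 : 0 < K2) by (unfold K2; apply Rmult_lt_0_compat; lra).
  assert (HTc : 0 <= T * / rho) by (apply Rmult_le_pos; lra).
  exists ((K1 + K2) * (1 + T * / rho)); split; [nra |].
  intros z t j Hz Hzt Ht.
  generalize (bounded_away_nonpole _ _ Hc Hz j)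
    (bounded_away_nonpole _ _ Hc Hzt j); intros Nz Nzt.
  set (l := RtoC (log_step j)); set (s := (/ (z + RtoC (INR j)))%C).
  (* g = (z + j) / (z + t + j), in the form that is bounded most easily. *)
  set (g := (1 - t * / (z + t + RtoC (INR j)))%C).
  replace (shift_factor z t j - 1 - t * log_increment z j)%C
    with (((Cexp (t * l) - 1 - t * l) - t * t * (s * (l - s))) * g)%C.
  2: { unfold shift_factor, log_increment, g, s; fold l; field; split; assumption. }
  rewrite Cmod_mult.
  generalize (inv_INR1 j) (Cmod_log_step_le j) (bounded_away_inv rho z j Hc Hz)
    (bounded_away_inv rho (z + t) j Hc Hzt) (Cmod_ge_0 t).
  fold l; fold s; rewrite inv_sq_sqr; set (q := / (INR j + 1)).
  intros Hq Hl Hs Hs' Ht0.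
  assert (Hg : Cmod g <= 1 + T * / rho).
  { unfold g, Cminus; apply Rle_trans with (1 := Cmod_triangle _ _).
    rewrite Cmod_1, Cmod_opp, Cmod_mult; apply Rplus_le_compat_l.
    apply Rmult_le_compat; auto using Cmod_ge_0. nra. }
  assert (H1 : Cmod (Cexp (t * l) - 1 - t * l) <= Cmod t ^ 2 * K1 * (q * q)).
  { apply Rle_trans with (1 := Cexp_taylor_bound _); rewrite Cmod_mult.
    generalize (Cmod_ge_0 l); intros Hl0.
    assert (E : exp (Cmod t * Cmod l) <= exp (7 * T)).
    { apply exp_le; rewrite (Rmult_comm 7); apply Rmult_le_compat; lra. }
    assert (Q : (Cmod t * Cmod l) ^ 2 <= Cmod t ^ 2 * (49 * (q * q))).
    { rewrite Rpow_mult_distr; apply Rmult_le_compat_l; [apply pow2_ge_0 |]; nra. }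
    apply Rle_trans with (5 * (Cmod t ^ 2 * (49 * (q * q))) * exp (7 * T)).
    - apply Rmult_le_compat; [| left; apply exp_pos | lra | exact E].
      generalize (pow2_ge_0 (Cmod t * Cmod l)); lra.
    - unfold K1; right; ring. }
  assert (H2 : Cmod (t * t * (s * (l - s))) <= Cmod t ^ 2 * K2 * (q * q)).
  { rewrite !Cmod_mult.
    assert (D : Cmod (l - s) <= (7 + / rho) * q).
    { unfold Cminus; apply Rle_trans with (1 := Cmod_triangle _ _).
      rewrite Cmod_opp; lra. }
    assert (M : Cmod s * Cmod (l - s) <= (/ rho * q) * ((7 + / rho) * q))
      by (apply Rmult_le_compat; auto using Cmod_ge_0).
    apply Rle_trans with (Cmod t * Cmod t * ((/ rho * q) * ((7 + / rho) * q))).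
    - apply Rmult_le_compat_l; [nra | exact M].
    - unfold K2; right; ring. }
  apply Rle_trans with
    ((Cmod t ^ 2 * K1 * (q * q) + Cmod t ^ 2 * K2 * (q * q)) * (1 + T * / rho)).
  - apply Rmult_le_compat; auto using Cmod_ge_0.
    unfold Cminus at 1; apply Rle_trans with (1 := Cmod_triangle _ _).
    rewrite Cmod_opp; now apply Rplus_le_compat.
  - right; ring.
Qed.

(** Each factor differs from 1 by O(1 / (j + 1)^2), with a constant depending on
    z and t. *)
Lemma shift_product_cv z t : nonpole z -> nonpole (z + t) ->
  exists L, Ccv (cprod (shift_factor z t)) L.
Proof.
  intros Hz Hzt.
  destruct (nonpole_bounded_away _ Hz) as [c1 [Hc1 B1]].
  destruct (nonpole_bounded_away _ Hzt) as [c2 [Hc2 B2]].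
  set (rho := Rmin c1 c2).
  assert (Hc : 0 < rho) by now apply Rmin_glb_lt.
  assert (A1 : bounded_away rho z).
  { intros j; apply Rle_trans with (2 := B1 j), Rmult_le_compat_r;
      [generalize (INR1_ge j); lra | apply Rmin_l]. }
  assert (A2 : bounded_away rho (z + t)).
  { intros j; apply Rle_trans with (2 := B2 j), Rmult_le_compat_r;
      [generalize (INR1_ge j); lra | apply Rmin_r]. }
  destruct (shift_factor_bound rho (Cmod t) Hc (Cmod_ge_0 t)) as [K [HK HB]].
  set (B := 6 + Cmod (z - 1) * / rho).
  assert (HB0 : 0 <= B).
  { unfold B; generalize (Cmod_ge_0 (z - 1)) (Rinv_0_lt_compat _ Hc); nra. }
  apply (cprod_cv _ inv_sq 2 (Cmod t * B + Cmod t ^ 2 * K)).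
  - apply sum_inv_sq_le.
  - generalize (Cmod_ge_0 t) (pow2_ge_0 (Cmod t)); nra.
  - apply ex_series_inv_sq.
  - intros j.
    replace (shift_factor z t j - 1)%C
      with (t * log_increment z j
            + (shift_factor z t j - 1 - t * log_increment z j))%C by ring.
    apply Rle_trans with (1 := Cmod_triangle _ _).
    rewrite Rmult_plus_distr_r; apply Rplus_le_compat.
    + rewrite Cmod_mult, Rmult_assoc; apply Rmult_le_compat_l; [apply Cmod_ge_0 |].
      now apply log_increment_bound.
    + apply HB; auto using Rle_refl.
Qed.

Lemma rising_1 n : rising 1 n = RtoC (INR (fact (S n))).
Proof.
  induction n as [|n IH].
  - cbn; f_equal; ring.
  - cbn [rising]; rewrite IH, (Nat.mul_comm (S (S n)) (fact (S n)) : fact (S (S n)) = _).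
    rewrite mult_INR, RtoC_mult, (S_INR (S n)), RtoC_plus; ring.
Qed.

Lemma nonpole_1 : nonpole 1.
Proof.
  intros j E; rewrite <- RtoC_plus in E; apply RtoC_inj in E.
  generalize (pos_INR j); lra.
Qed.

(** The approximation of Gamma(1) is n / (n + 1): this is the base point from which
    all other values are reached. *)
Lemma euler_1_cv : Ccv (euler 1) 1.
Proof.
  apply Ccv_incr_1.
  apply Ccv_ext with (fun n => RtoC (INR (S n) / INR (S (S n)))).
  - intros n; unfold euler, Rcpow; rewrite rising_1, Cmult_1_l.
    assert (P1 : 0 < INR (S n)) by (apply lt_0_INR; lia).
    assert (P2 : 0 < INR (fact (S n))) by apply INR_fact_lt_0.
    assert (P3 : 0 < INR (S (S n))) by (apply lt_0_INR; lia).
    replace (Cexp (RtoC (ln (INR (S n))))) with (RtoC (INR (S n))).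
    2: { unfold Cexp; cbn [Re Im fst snd RtoC].
         rewrite exp_ln, cos_0, sin_0 by assumption.
         now rewrite Rmult_1_r, Rmult_0_r. }
    rewrite (eq_refl : fact (S (S n)) = (S (S n) * fact (S n))%nat), mult_INR.
    rewrite <- RtoC_mult, <- RtoC_div by nra.
    f_equal; field; lra.
  - apply Ccv_RtoC.
    apply is_lim_seq_ext with (fun n => 1 - / (INR n + 2)).
    + intros n; rewrite !S_INR; generalize (pos_INR n); intros; field; lra.
    + replace 1 with (1 - 0) at 1 by ring.
      apply is_lim_seq_minus'; [apply is_lim_seq_const |].
      replace (Finite 0) with (Rbar_inv p_infty) by reflexivity.
      apply is_lim_seq_inv; [| discriminate].
      eapply is_lim_seq_plus;
        [apply is_lim_seq_INR | apply is_lim_seq_const | reflexivity].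
Qed.

(** The shift from 1 to z gives the limit.  The shift back from z to 1 also
    converges, and it multiplies the limit to 1, so the limit is not 0. *)
Lemma Gamma_cv z : nonpole z -> Ccv (euler z) (Gamma z) /\ Gamma z <> 0.
Proof.
  intros Hz.
  assert (E1 : (1 + (z - 1))%C = z) by ring.
  assert (E2 : (z + (1 - z))%C = 1) by ring.
  destruct (shift_product_cv 1 (z - 1)) as [L HL];
    [exact nonpole_1 | rewrite E1; exact Hz |].
  destruct (shift_product_cv z (1 - z)) as [L' HL'];
    [exact Hz | rewrite E2; exact nonpole_1 |].
  assert (Hcv : Ccv (euler z) L).
  { rewrite <- (Cmult_1_l L).
    apply Ccv_ext with (fun n => euler 1 n * cprod (shift_factor 1 (z - 1)) n)%C.
    - intros n; rewrite <- euler_shift, E1; auto using nonpole_1; now rewrite E1.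
    - now apply Ccv_mult; [apply euler_1_cv |]. }
  assert (EG : Gamma z = L) by exact (Ccv_Clim_seq _ _ Hcv).
  rewrite EG; split; [exact Hcv |].
  intros L0; apply C1_nz.
  rewrite <- (Cmult_0_l L'), <- L0.
  apply (Ccv_unique (euler 1)); [apply euler_1_cv |].
  apply Ccv_ext with (fun n => euler z n * cprod (shift_factor z (1 - z)) n)%C.
  - intros n; rewrite <- euler_shift, E2; auto; rewrite E2; exact nonpole_1.
  - now apply Ccv_mult.
Qed.

(** * The logarithmic derivative of Gamma *)

Lemma log_increment_cv z : nonpole z -> exists h, Ccv (sum_n (log_increment z)) h.
Proof.
  intros Hz; destruct (nonpole_bounded_away _ Hz) as [rho [Hc B]].
  apply (Ccv_summable_increments _ (fun n => inv_sq (S n)) (6 + Cmod (z - 1) * / rho)).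
  - apply (ex_series_incr_1 inv_sq), ex_series_inv_sq.
  - intros n; rewrite csum_S.
    replace (sum_n (log_increment z) n + log_increment z (S n)
      - sum_n (log_increment z) n)%C with (log_increment z (S n)) by ring.
    now apply log_increment_bound.
Qed.

(** The second-order estimate for the products holds with one constant for all n, so
    it holds for the quotient Gamma(z + t) / Gamma(z). *)
Lemma Gamma_taylor z h : nonpole z -> Ccv (sum_n (log_increment z)) h ->
  exists M d, 0 < d /\ forall t, Cmod t <= d ->
    Cmod (Gamma (z + t) - Gamma z - Gamma z * (t * h)) <= M * Cmod t ^ 2.
Proof.
  intros Hz Hh; destruct (nonpole_bounded_away _ Hz) as [rho [Hc B]].
  assert (Hc2 : 0 < rho / 2) by lra.
  assert (B2 : bounded_away (rho / 2) z).
  { intros j; apply Rle_trans with (2 := B j), Rmult_le_compat_r;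
      [generalize (INR1_ge j) |]; lra. }
  destruct (shift_factor_bound (rho / 2) 1 Hc2 Rle_0_1) as [K [HK HB]].
  set (B0 := 6 + Cmod (z - 1) * / rho).
  assert (HB0 : 0 <= B0).
  { unfold B0; generalize (Cmod_ge_0 (z - 1)) (Rinv_0_lt_compat _ Hc); nra. }
  set (A := B0 + K).
  set (M := (A * A * exp (A * 2) * 2 + K) * 2).
  exists (Cmod (Gamma z) * M), (Rmin 1 (rho / 2)); split; [apply Rmin_glb_lt; lra |].
  intros t Ht.
  assert (T1 : Cmod t <= 1) by (apply Rle_trans with (1 := Ht), Rmin_l).
  assert (T2 : Cmod t <= rho / 2) by (apply Rle_trans with (1 := Ht), Rmin_r).
  generalize (bounded_away_perturb rho z t B T2); intros B3.
  assert (Hzt : nonpole (z + t)) by now apply (bounded_away_nonpole (rho / 2)).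
  destruct (shift_product_cv z t Hz Hzt) as [L HL].
  assert (EG : Gamma (z + t) = (Gamma z * L)%C).
  { apply (Ccv_unique (euler (z + t))); [now apply Gamma_cv |].
    apply Ccv_ext with (fun n => euler z n * cprod (shift_factor z t) n)%C.
    - intros n; symmetry; now apply euler_shift.
    - apply Ccv_mult; [now apply Gamma_cv | exact HL]. }
  rewrite EG.
  replace (Gamma z * L - Gamma z - Gamma z * (t * h))%C
    with (Gamma z * (L - 1 + - t * h - 0))%C by ring.
  rewrite Cmod_mult, Rmult_assoc; apply Rmult_le_compat_l; [apply Cmod_ge_0 |].
  apply Ccv_Cmod_le with
    (fun n => cprod (shift_factor z t) n + - (1) + - t * sum_n (log_increment z) n)%C.
  - apply Ccv_plus; [apply Ccv_plus; [exact HL | apply Ccv_const] | now apply Ccv_scal].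
  - intros n; rewrite (Rmult_comm M).
    replace (cprod (shift_factor z t) n + - (1) + - t * sum_n (log_increment z) n - 0)%C
      with (cprod (shift_factor z t) n - 1 - t * sum_n (log_increment z) n)%C by ring.
    apply (cprod_second_order _ inv_sq 2); auto using inv_sq_pos, sum_inv_sq_le.
    now apply log_increment_bound.
Qed.

Lemma C_derive_of_taylor (f : C -> C) (z l : C) (M d : R) : 0 < d ->
  (forall t, Cmod t <= d -> Cmod (f (z + t)%C - f z - t * l) <= M * Cmod t ^ 2) ->
  C_derive f z = l.
Proof.
  intros Hd H; unfold C_derive; apply is_C_lim_unique.
  apply filterlim_locally; intros eps.
  (* A positive majorant of M, which may be nonpositive. *)
  set (M' := Rabs M + 1).
  assert (HM : 0 < M') by (unfold M'; generalize (Rabs_pos M); lra).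
  assert (Hr : 0 < Rmin d (eps / M') / 2).
  { apply Rdiv_lt_0_compat; [| lra].
    apply Rmin_glb_lt; [exact Hd | apply Rdiv_lt_0_compat; [apply cond_pos | exact HM]]. }
  exists (mkposreal _ Hr); intros x [Bx By] Hx.
  cbn [pos] in Bx, By.
  assert (Hxz : (x - z)%C <> 0) by now apply Cminus_eq_contra.
  set (t := (x - z)%C) in *.
  assert (Hsmall : Cmod t < Rmin d (eps / M')).
  { apply Rle_lt_trans with (1 := Cmod_le_Re_Im t).
    assert (Rabs (Re t) < Rmin d (eps / M') / 2) by exact Bx.
    assert (Rabs (Im t) < Rmin d (eps / M') / 2) by exact By.
    lra. }
  assert (Hq : Cmod ((f x - f z) / t - l) < eps).
  { replace ((f x - f z) / t - l)%C with ((f x - f z - t * l) / t)%C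
      by (field; exact Hxz).
    rewrite Cmod_div by exact Hxz.
    assert (Ht : 0 < Cmod t) by now apply Cmod_gt_0.
    replace x with (z + t)%C at 1 by (unfold t; ring).
    apply Rle_lt_trans with (M' * Cmod t).
    - apply Rmult_le_reg_r with (1 := Ht).
      replace (Cmod (f (z + t)%C - f z - t * l) / Cmod t * Cmod t)
        with (Cmod (f (z + t)%C - f z - t * l)) by (field; lra).
      apply Rle_trans with (1 := H t ltac:(generalize (Rmin_l d (eps / M')); lra)).
      unfold M'; generalize (Rle_abs M) (pow2_ge_0 (Cmod t)); nra.
    - apply Rlt_le_trans with (M' * (eps / M')).
      + apply Rmult_lt_compat_l; [exact HM |].
        generalize (Rmin_r d (eps / M')); lra.
      + right; field; lra. }
  split.
  - apply Rle_lt_trans with (2 := Hq).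
    exact (re_le_Cmod ((f x - f z) / t - l)%C).
  - apply Rle_lt_trans with (2 := Hq).
    exact (im_le_Cmod ((f x - f z) / t - l)%C).
Qed.

(** The factor Gamma(z) of the derivative cancels because it is not 0. *)
Lemma digamma_cv z : nonpole z -> Ccv (sum_n (log_increment z)) (digamma z).
Proof.
  intros Hz; destruct (log_increment_cv z Hz) as [h Hh].
  destruct (Gamma_taylor z h Hz Hh) as [M [d [Hd HT]]].
  destruct (Gamma_cv z Hz) as [_ HG].
  replace (digamma z) with h; [exact Hh |].
  unfold digamma; rewrite (C_derive_of_taylor Gamma z (Gamma z * h) M d Hd).
  - now field.
  - intros t Ht; replace (t * (Gamma z * h))%C with (Gamma z * (t * h))%C by ring.
    now apply HT.
Qed.

(** * Roots of -1 and partial fractions *)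

(** The ratio of consecutive [omega k r]. *)
Definition theta (k : nat) : C :=
  Cexp (RtoC (2 * PI / INR (2 * k + 1)) * Ci).

Lemma INR_odd_pos k : 0 < INR (2 * k + 1).
Proof. apply lt_0_INR; lia. Qed.

Lemma Cexp_imaginary x : Cexp (RtoC x * Ci) = (cos x, sin x).
Proof.
  unfold Cexp; cbn.
  replace (x * 0 - 0 * 1) with 0 by ring; replace (x * 1 + 0 * 0) with x by ring.
  now rewrite exp_0, !Rmult_1_l.
Qed.

Lemma omega_eq k r :
  omega k r = Cexp (RtoC (2 * PI / INR (2 * k + 1) * (INR r + / 2)) * Ci).
Proof.
  unfold omega; f_equal.
  generalize (INR_odd_pos k); intros HN.
  assert (H2 : RtoC 2 <> 0) by (intros E; apply RtoC_inj in E; lra).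
  assert (HN' : RtoC (INR (2 * k + 1)) <> 0) by (intros E; apply RtoC_inj in E; lra).
  rewrite RtoC_mult, RtoC_div, RtoC_plus, RtoC_inv, RtoC_mult by lra.
  field; assumption.
Qed.

Lemma omega_S k r : omega k (S r) = (omega k r * theta k)%C.
Proof.
  rewrite !omega_eq; unfold theta; rewrite <- Cexp_plus; f_equal.
  rewrite S_INR, <- Cmult_plus_distr_r, <- RtoC_plus; do 2 f_equal; ring.
Qed.

Lemma theta_pow k : (theta k ^ (2 * k + 1))%C = 1.
Proof.
  unfold theta; rewrite Cexp_pow, Cmult_assoc, <- RtoC_mult, Cexp_imaginary.
  replace (INR (2 * k + 1) * (2 * PI / INR (2 * k + 1))) with (2 * PI)
    by (field; generalize (INR_odd_pos k); lra).
  now rewrite cos_2PI, sin_2PI.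
Qed.

Lemma omega_pow k r : (omega k r ^ (2 * k + 1) = - (1))%C.
Proof.
  induction r as [|r IH].
  - rewrite omega_eq, Cexp_pow, Cmult_assoc, <- RtoC_mult, Cexp_imaginary; cbn [INR].
    replace (INR (2 * k + 1) * (2 * PI / INR (2 * k + 1) * (0 + / 2))) with PI
      by (field; generalize (INR_odd_pos k); lra).
    rewrite cos_PI, sin_PI, <- RtoC_opp; reflexivity.
  - now rewrite omega_S, Cpow_mult_l, IH, theta_pow, Cmult_1_r.
Qed.

(** By the half-angle formula the real part is 1 - 2 sin(y)^2 with
    y = pi m / (2 k + 1) strictly between 0 and pi. *)
Lemma theta_pow_neq_1 k m : (0 < m < 2 * k + 1)%nat -> (theta k ^ m)%C <> 1.
Proof.
  intros Hm; unfold theta.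
  rewrite Cexp_pow, Cmult_assoc, <- RtoC_mult, Cexp_imaginary; intros E.
  apply (f_equal fst) in E; cbn [fst RtoC] in E.
  set (y := INR m * PI / INR (2 * k + 1)).
  replace (INR m * (2 * PI / INR (2 * k + 1))) with (2 * y) in E
    by (unfold y; field; generalize (INR_odd_pos k); lra).
  rewrite cos_2a_sin in E.
  assert (Hy : 0 < y < PI).
  { generalize (INR_odd_pos k) PI_RGT_0 (lt_0_INR m ltac:(lia))
      (lt_INR m (2 * k + 1) ltac:(lia)); intros HN HP H0 H1; unfold y; split.
    - apply Rdiv_lt_0_compat; [now apply Rmult_lt_0_compat | exact HN].
    - apply Rmult_lt_reg_r with (1 := HN); field_simplify; nra. }
  generalize (sin_gt_0 y (proj1 Hy) (proj2 Hy)); nra.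
Qed.

(** A geometric sum of ratio theta^m.  The form without division is proved first,
    as the quotient needs theta^m to differ from 1. *)
Lemma sum_omega_pow_telescope k m n :
  ((theta k ^ m - 1) * sum_n (fun r => omega k r ^ m) n
   = omega k (S n) ^ m - omega k 0 ^ m)%C.
Proof.
  induction n as [|n IH].
  - rewrite csum_0, omega_S, Cpow_mult_l; ring.
  - rewrite csum_S, Cmult_plus_distr_l, IH, (omega_S k (S n)), Cpow_mult_l; ring.
Qed.

Lemma omega_period k : omega k (S (2 * k)) = omega k 0.
Proof.
  assert (H : forall n, omega k n = (omega k 0 * theta k ^ n)%C).
  { induction n as [|n IH]; [cbn [Cpow]; ring |].
    rewrite omega_S, IH, Cpow_S; ring. }
  rewrite H; replace (S (2 * k)) with (2 * k + 1)%nat by lia.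
  rewrite theta_pow; ring.
Qed.

Lemma sum_omega_pow_0 k m : (0 < m < 2 * k + 1)%nat ->
  sum_n (fun r => omega k r ^ m)%C (2 * k) = 0 :> C.
Proof.
  intros Hm.
  generalize (sum_omega_pow_telescope k m (2 * k)).
  rewrite omega_period; set (s := sum_n _ _); intros E.
  generalize (Cminus_eq_contra _ _ (theta_pow_neq_1 k m Hm)); intros Hne.
  replace s with (((theta k ^ m - 1) * s) / (theta k ^ m - 1))%C by now field.
  rewrite E; field; exact Hne.
Qed.

Lemma sum_const_C (a : C) n : sum_n (fun _ => a) n = (RtoC (INR (S n)) * a)%C :> C.
Proof.
  induction n as [|n IH].
  - rewrite csum_0; cbn [INR]; ring.
  - rewrite csum_S, IH, (S_INR (S n)), RtoC_plus; ring.
Qed.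

Lemma sum_omega_pow_N k :
  sum_n (fun r => omega k r ^ (2 * k + 1))%C (2 * k) = (- RtoC (INR (2 * k + 1)))%C :> C.
Proof.
  rewrite (csum_ext _ (fun _ => - (1))%C) by (intros r _; apply omega_pow).
  rewrite sum_const_C; replace (S (2 * k)) with (2 * k + 1)%nat by lia; ring.
Qed.

(** The cofactor of x - y in x^(n+1) - y^(n+1), written by Horner's scheme to avoid
    a subtraction in the exponents. *)
Fixpoint geom_sum (x y : C) (n : nat) : C :=
  match n with
  | O => 1
  | S m => (x * geom_sum x y m + y ^ n)%C
  end.

Lemma geom_sum_telescope x y n : ((x - y) * geom_sum x y n = x ^ S n - y ^ S n)%C.
Proof.
  induction n as [|n IH]; [cbn; ring |].
  cbn [geom_sum].
  rewrite Cmult_plus_distr_l, Cmult_assoc, (Cmult_comm _ x), <- Cmult_assoc, IH.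
  rewrite !Cpow_S; ring.
Qed.

(** Only the top power of omega_r survives: expanding by Horner's scheme, each lower
    power comes with a vanishing power sum. *)
Lemma sum_omega_geom_sum k (x w : C) n : (n <= 2 * k)%nat ->
  sum_n (fun r => omega k r * geom_sum x (omega k r * w) n)%C (2 * k)
  = (w ^ n * sum_n (fun r => omega k r ^ S n) (2 * k))%C :> C.
Proof.
  induction n as [|n IH]; intros Hn.
  - cbn [Cpow]; rewrite Cmult_1_l; apply csum_ext; intros r _; cbn; ring.
  - rewrite (csum_ext _ (fun r => x * (omega k r * geom_sum x (omega k r * w) n)
      + w ^ S n * omega k r ^ S (S n))%C).
    + rewrite csum_plus, !csum_scal, IH, sum_omega_pow_0 by lia; ring.
    + intros r _; cbn [geom_sum]; rewrite Cpow_mult_l, !Cpow_S; ring.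
Qed.

Definition c_term (k : nat) (w : R) (j : nat) : R :=
  w ^ (2 * k) / (INR j ^ (2 * k + 1) + w ^ (2 * k + 1)).

(** As omega_r^N = -1, the difference j^N - (omega_r w)^N is j^N + w^N, the common
    denominator of the partial fractions. *)
Lemma omega_factor k r (w : R) j :
  ((RtoC (INR j) - omega k r * RtoC w)
     * geom_sum (RtoC (INR j)) (omega k r * RtoC w) (2 * k)
   = RtoC (INR j ^ (2 * k + 1) + w ^ (2 * k + 1)))%C.
Proof.
  rewrite geom_sum_telescope; replace (S (2 * k)) with (2 * k + 1)%nat by lia.
  rewrite Cpow_mult_l, omega_pow, <- !RtoC_pow, RtoC_plus; ring.
Qed.

Lemma c_term_denominator_pos k w j : 0 < w ->
  0 < INR j ^ (2 * k + 1) + w ^ (2 * k + 1).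
Proof.
  intros Hw; generalize (pow_le _ (2 * k + 1) (pos_INR j)) (pow_lt w (2 * k + 1) Hw); lra.
Qed.

(** A pole would be a zero of a factor of j^N + w^N, which is positive. *)
Lemma nonpole_omega k r w : 0 < w -> nonpole (- omega k r * RtoC w)%C.
Proof.
  intros Hw j E.
  generalize (omega_factor k r w j) (c_term_denominator_pos k w j Hw).
  replace (RtoC (INR j) - omega k r * RtoC w)%C
    with (- omega k r * RtoC w + RtoC (INR j))%C by ring.
  rewrite E, Cmult_0_l; intros F; apply RtoC_inj in F; lra.
Qed.

(** Expand 1 / (j - omega_r w) over the common denominator j^N + w^N.  The first
    power sum of the omega_r removes [log_step j], and in the expansion only
    omega_r^N = -1 has a nonzero sum over r. *)
Lemma partial_fraction k w j : (1 <= k)%nat -> 0 < w ->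
  (1 / RtoC (INR (2 * k + 1)) * sum_n (fun r => omega k r
     * log_increment (- omega k r * RtoC w) j) (2 * k))%C
  = RtoC (c_term k w j).
Proof.
  intros Hk Hw.
  set (D := INR j ^ (2 * k + 1) + w ^ (2 * k + 1)).
  assert (HD : 0 < D) by now apply c_term_denominator_pos.
  assert (HD' : RtoC D <> 0) by (intros E; apply RtoC_inj in E; lra).
  assert (HN' : RtoC (INR (2 * k + 1)) <> 0)
    by (intros E; apply RtoC_inj in E; generalize (INR_odd_pos k); lra).
  rewrite (csum_ext _ (fun r => RtoC (log_step j) * omega k r ^ 1
    + - / RtoC D * (omega k r * geom_sum (RtoC (INR j)) (omega k r * RtoC w) (2 * k)))%C).
  - rewrite csum_plus, !csum_scal, sum_omega_pow_0, sum_omega_geom_sum by lia.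
    replace (S (2 * k)) with (2 * k + 1)%nat by lia; rewrite sum_omega_pow_N.
    unfold c_term; fold D; rewrite RtoC_div, RtoC_pow by lra.
    field; split; assumption.
  - intros r _; rewrite Cpow_1_r; unfold log_increment.
    replace (- omega k r * RtoC w + RtoC (INR j))%C
      with (RtoC (INR j) - omega k r * RtoC w)%C by ring.
    generalize (omega_factor k r w j); fold D.
    set (u := (RtoC (INR j) - omega k r * RtoC w)%C); set (g := geom_sum _ _ _); intros E.
    assert (Hu : u <> 0) by (intros E0; rewrite E0, Cmult_0_l in E; now symmetry in E).
    assert (Hg : g <> 0) by (intros E0; rewrite E0, Cmult_0_r in E; now symmetry in E).
    rewrite <- E; field; split; assumption.
Qed.

Lemma c_series k w : (1 <= k)%nat -> 0 < w ->
  exists s : R, is_series (c_term k w) s /\ c k w = RtoC s.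
Proof.
  intros Hk Hw.
  assert (H : Ccv (fun n => RtoC (sum_n (c_term k w) n)) (c k w)).
  { apply Ccv_ext with (fun n => 1 / RtoC (INR (2 * k + 1)) * sum_n (fun r =>
      omega k r * sum_n (log_increment (- omega k r * RtoC w)) n) (2 * k))%C.
    - intros n; rewrite <- csum_RtoC, <- csum_scal.
      rewrite (csum_ext (fun j => RtoC (c_term k w j)) (fun j => sum_n (fun r =>
        1 / RtoC (INR (2 * k + 1)) * (omega k r
          * log_increment (- omega k r * RtoC w) j)) (2 * k))%C).
      + rewrite <- (sum_n_switch (G := C_AbelianMonoid)).
        apply csum_ext; intros r _; now rewrite !csum_scal.
      + intros j _; rewrite csum_scal; symmetry; now apply partial_fraction.
    - apply Ccv_scal, (Ccv_sum (fun r n =>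
        omega k r * sum_n (log_increment (- omega k r * RtoC w)) n)%C).
      intros r _; now apply Ccv_scal, digamma_cv, nonpole_omega. }
  exists (Re (c k w)); exact (Ccv_real _ _ H).
Qed.

(** * Zeta values and the symmetrised double series *)

Definition zterm (s n : nat) : R := / INR (S n) ^ s.

Lemma INR_S_pos n : 0 < INR (S n).
Proof. apply lt_0_INR; lia. Qed.

Lemma zterm_pos s n : 0 < zterm s n.
Proof. apply Rinv_0_lt_compat, pow_lt, INR_S_pos. Qed.

Lemma ex_series_zterm s : (2 <= s)%nat -> ex_series (zterm s).
Proof.
  intros Hs.
  apply (ex_series_le (K := R_AbsRing) (V := R_CompleteNormedModule) _ inv_sq);
    [| apply ex_series_inv_sq].
  intros n; change (Rabs (zterm s n) <= inv_sq n).
  rewrite Rabs_pos_eq by (left; apply zterm_pos).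
  unfold zterm, inv_sq; rewrite S_INR.
  apply Rinv_le_contravar.
  - apply pow_lt; rewrite <- S_INR; apply INR_S_pos.
  - apply Rle_pow; [apply INR1_ge | exact Hs].
Qed.

Lemma zeta_series s : (2 <= s)%nat ->
  exists Z : R, is_series (zterm s) Z /\ zeta (RtoC (INR s)) = RtoC Z.
Proof.
  intros Hs; destruct (ex_series_zterm s Hs) as [Z HZ].
  exists Z; split; [exact HZ |].
  unfold zeta; apply Ccv_Clim_seq.
  apply Ccv_ext with (fun n => RtoC (sum_n (zterm s) n)); [| exact (Ccv_RtoC _ _ HZ)].
  intros n; rewrite <- csum_RtoC; apply csum_ext; intros j _.
  generalize (INR_S_pos j); intros Hj.
  unfold zterm, Rcpow.
  rewrite <- RtoC_opp, <- RtoC_mult; unfold Cexp; cbn [Re Im fst snd RtoC].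
  rewrite cos_0, sin_0, Rmult_1_r, Rmult_0_r.
  unfold RtoC; f_equal.
  rewrite <- Ropp_mult_distr_l, exp_Ropp, <- ln_pow, exp_ln
    by (try apply pow_lt; exact Hj).
  reflexivity.
Qed.

Lemma rsum_plus (a b : nat -> R) n :
  sum_n (fun j => a j + b j) n = sum_n a n + sum_n b n.
Proof. exact (sum_n_plus a b n). Qed.

Lemma rsum_scal (x : R) (a : nat -> R) n :
  sum_n (fun j => x * a j) n = x * sum_n a n.
Proof. exact (sum_n_mult_l x a n). Qed.

Lemma rsum_le (a b : nat -> R) n : (forall j, a j <= b j) -> sum_n a n <= sum_n b n.
Proof.
  intros H; induction n as [|n IH].
  - rewrite !rsum_0; apply H.
  - rewrite !rsum_S; generalize (H (S n)); lra.
Qed.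

Lemma rsum_incr (a : nat -> R) n m :
  (forall j, 0 <= a j) -> (n <= m)%nat -> sum_n a n <= sum_n a m.
Proof.
  intros Ha H; induction H as [|m H IH]; [lra |].
  rewrite rsum_S; generalize (Ha (S m)); lra.
Qed.

Lemma rsum_le_series (a : nat -> R) l n :
  (forall j, 0 <= a j) -> is_series a l -> sum_n a n <= l.
Proof.
  intros Ha Hl.
  refine (is_lim_seq_le_loc (fun _ => sum_n a n) _ (Finite _) (Finite _) _
    (is_lim_seq_const _) Hl).
  exists n; intros m Hm; now apply rsum_incr.
Qed.

(** Over a square, a double sum equals its transpose, so twice the sum is the sum of
    T n m + T m n. *)
Lemma symmetrised_square_sum (a : nat -> R) (T : nat -> nat -> R) M :
  (forall n m, T n m + T m n = a n * a m) ->
  sum_n (fun n => sum_n (T n) M) M = / 2 * (sum_n a M) ^ 2.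
Proof.
  intros T_sym.
  assert (E : sum_n (fun n => sum_n (T n) M) M + sum_n (fun n => sum_n (T n) M) M
    = sum_n a M * sum_n a M).
  { rewrite (sum_n_switch (G := R_AbelianMonoid) T M M) at 2.
    rewrite <- rsum_plus, <- rsum_scal.
    apply (sum_n_ext (G := R_AbelianMonoid)); intros n.
    rewrite <- rsum_plus, Rmult_comm, <- rsum_scal.
    apply (sum_n_ext (G := R_AbelianMonoid)); intros m; apply T_sym. }
  change (sum_n (fun n => sum_n (T n) M) M = / 2 * (sum_n a M) ^ 2 :> R); lra.
Qed.

(** The M-th partial sum of u is squeezed.  It dominates the sum of T over the square
    of side M; it is a limit of sums over rectangles, and each rectangle lies in
    a larger square, whose sum is at most Z^2 / 2. *)
Lemma symmetrised_double_series (a : nat -> R) (T : nat -> nat -> R)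
    (u : nat -> R) (Z : R) :
  (forall n, 0 <= a n) -> (forall n m, 0 <= T n m) ->
  (forall n m, T n m + T m n = a n * a m) ->
  is_series a Z -> (forall n, is_series (T n) (u n)) ->
  is_series u (/ 2 * Z ^ 2).
Proof.
  intros a_pos T_pos T_sym a_series u_series.
  assert (HZ : forall n, 0 <= sum_n a n <= Z).
  { intros n; split; [| now apply rsum_le_series].
    induction n as [|n IH]; [rewrite rsum_0; auto |].
    rewrite rsum_S; generalize (a_pos (S n)); lra. }
  change (is_lim_seq (sum_n u) (/ 2 * Z ^ 2)).
  apply (is_lim_seq_le_le (fun M => / 2 * (sum_n a M) ^ 2) _ (fun _ => / 2 * Z ^ 2)).
  - intros M; split.
    + rewrite <- (symmetrised_square_sum a T M T_sym); apply rsum_le.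
      intros n; now apply rsum_le_series.
    + assert (L : is_lim_seq (fun p => sum_n (fun n => sum_n (T n) p) M) (sum_n u M)).
      { induction M as [|M IH].
        - rewrite rsum_0; apply is_lim_seq_ext with (sum_n (T 0%nat));
            [intros p; now rewrite rsum_0 | apply u_series].
        - rewrite rsum_S.
          apply is_lim_seq_ext
            with (fun p => sum_n (fun n => sum_n (T n) p) M + sum_n (T (S M)) p).
          + intros p; now rewrite rsum_S.
          + apply is_lim_seq_plus'; [exact IH | apply u_series]. }
      refine (is_lim_seq_le_loc _ (fun _ => / 2 * Z ^ 2) (Finite _) (Finite _) _ L
        (is_lim_seq_const _)).
      exists M; intros p Hp.
      apply Rle_trans with (sum_n (fun n => sum_n (T n) p) p).
      * apply rsum_incr; [| exact Hp]; intros n.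
        apply Rle_trans with (T n 0%nat); [apply T_pos |].
        rewrite <- (rsum_0 (T n)); apply rsum_incr; [apply T_pos | lia].
      * rewrite (symmetrised_square_sum a T p T_sym); apply Rmult_le_compat_l; [lra |].
        apply pow_incr, HZ.
  - apply (is_lim_seq_scal_l _ (/ 2) (Finite (Z ^ 2))).
    apply is_lim_seq_ext with (fun n => sum_n a n * sum_n a n); [intros n; ring |].
    replace (Z ^ 2) with (Z * Z) by ring; now apply is_lim_seq_mult'.
  - apply is_lim_seq_const.
Qed.

(** The terms of index m + 1 >= 1 of the series for c_k(n + 1), after division by
    (n + 1)^(4 k + 1). *)
Definition offdiag (N n m : nat) : R :=
  / (INR (S n) ^ N * (INR (S n) ^ N + INR (S m) ^ N)).

Lemma pow_INR_S_pos N n : 0 < INR (S n) ^ N.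
Proof. apply pow_lt, INR_S_pos. Qed.

(** The term of index 0 of the series for c_k is split off: it produces the terms
    of zeta (4 k + 2). *)
Lemma c_scaled_series k n : (1 <= k)%nat ->
  exists u : R, is_series (offdiag (2 * k + 1) n) u /\
    (c k (INR (S n)) / RtoC (INR (S n)) ^ (4 * k + 1))%C
      = RtoC (u + zterm (4 * k + 2) n).
Proof.
  intros Hk.
  set (N := (2 * k + 1)%nat); set (w := INR (S n)).
  assert (Hw : 0 < w) by apply INR_S_pos.
  destruct (c_series k w Hk Hw) as [s [Hs Ec]].
  assert (HwN : forall p, 0 < w ^ p) by (intros p; now apply pow_lt).
  set (q := w ^ (4 * k + 1)).
  assert (Hq : 0 < q) by apply HwN.
  assert (Eq1 : q = w ^ (2 * k) * w ^ N) by (unfold q; rewrite <- pow_add; f_equal; lia).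
  assert (Eq2 : w ^ (4 * k + 2) = w ^ N * w ^ N) by (rewrite <- pow_add; f_equal; lia).
  exists (s / q - zterm (4 * k + 2) n); split.
  - apply (is_series_ext (fun j => c_term k w (S j) * / q)).
    + intros m; change (c_term k w (S m) * / q = offdiag N n m :> R).
      unfold c_term, offdiag; fold w N; rewrite Eq1.
      generalize (HwN (2 * k)%nat) (HwN N) (pow_INR_S_pos N m); intros; field; lra.
    + replace (s / q - zterm (4 * k + 2) n) with ((s - c_term k w 0) * / q).
      * apply (is_series_scal_r (/ q) (fun j => c_term k w (S j))).
        apply (is_series_incr_1 (c_term k w)).
        change (is_series (c_term k w) (s - c_term k w 0 + c_term k w 0)).
        now replace (s - c_term k w 0 + c_term k w 0) with s by ring.
      * unfold zterm, c_term; fold w N; rewrite Eq2, Eq1.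
        replace (INR 0 ^ N) with 0
          by (cbn [INR]; rewrite pow_i; [reflexivity | unfold N; lia]).
        generalize (HwN (2 * k)%nat) (HwN N); intros; field; lra.
  - rewrite Ec, <- RtoC_pow, <- RtoC_div by (fold q; lra).
    f_equal; fold q; unfold Rdiv; ring.
Qed.

Theorem theorem3 : forall k : nat, (1 <= k)%nat ->
  @is_series C_AbsRing C_NormedModule
    (fun n : nat => (c k (INR (S n)) / RtoC (INR (S n)) ^ (4 * k + 1))%C)
    (1 / 2 * zeta (RtoC (INR (2 * k + 1))) ^ 2
     + zeta (RtoC (INR (4 * k + 2))))%C.
Proof.
  intros k Hk; set (N := (2 * k + 1)%nat).
  destruct (zeta_series N ltac:(lia)) as [Z [HZ EZ]].
  destruct (zeta_series (4 * k + 2) ltac:(lia)) as [Z2 [HZ2 EZ2]].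
  rewrite EZ, EZ2.
  assert (Hu : forall n, exists u : R, is_series (offdiag N n) u /\
    (c k (INR (S n)) / RtoC (INR (S n)) ^ (4 * k + 1))%C
      = RtoC (u + zterm (4 * k + 2) n)).
  { intros n; now apply c_scaled_series. }
  (* The sums u n are named explicitly, as real parts, to avoid choosing them. *)
  set (u := fun n => Re (c k (INR (S n)) / RtoC (INR (S n)) ^ (4 * k + 1))%C
    - zterm (4 * k + 2) n).
  assert (Hu1 : forall n, is_series (offdiag N n) (u n)).
  { intros n; destruct (Hu n) as [v [Hv Ev]]; unfold u; rewrite Ev; cbn [Re RtoC fst].
    now replace (v + zterm (4 * k + 2) n - zterm (4 * k + 2) n) with v by ring. }
  assert (Hu2 : forall n, (c k (INR (S n)) / RtoC (INR (S n)) ^ (4 * k + 1))%C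
      = RtoC (u n + zterm (4 * k + 2) n)).
  { intros n; destruct (Hu n) as [v [Hv Ev]]; unfold u; rewrite Ev; cbn [Re RtoC fst].
    f_equal; ring. }
  assert (S1 : is_series u (/ 2 * Z ^ 2)).
  { apply symmetrised_double_series with (a := zterm N) (T := offdiag N); auto.
    - intros n; left; apply zterm_pos.
    - intros n m; unfold offdiag.
      generalize (pow_INR_S_pos N n) (pow_INR_S_pos N m); intros.
      left; apply Rinv_0_lt_compat, Rmult_lt_0_compat; lra.
    - intros n m; unfold offdiag, zterm.
      generalize (pow_INR_S_pos N n) (pow_INR_S_pos N m); intros; field; lra. }
  apply (Ccv_filterlim (sum_n _)).
  apply Ccv_ext with (fun n => RtoC (sum_n (fun j => u j + zterm (4 * k + 2) j) n)).
  - intros n; rewrite <- csum_RtoC; apply csum_ext; intros j _; now rewrite Hu2.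
  - replace (1 / 2 * RtoC Z ^ 2 + RtoC Z2)%C with (RtoC (/ 2 * Z ^ 2 + Z2)).
    + apply Ccv_RtoC; exact (is_series_plus _ _ _ _ S1 HZ2).
    + rewrite RtoC_plus, RtoC_mult, RtoC_pow, RtoC_inv by lra.
      field; intros E; apply RtoC_inj in E; lra.
Qed.
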